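(* Let $\mathcal U\subset\mathbb R^{n_\xi}$ be convex (and compact), and let $g:\mathcal X\times\mathcal Y\times\mathcal U\to\mathbb R$ be a continuous function such that $\xi\mapsto g(x,y,\xi)$ is concave for every $x\in\mathcal X$, $y\in\mathcal Y$. Furthermore, assume that for every $x\in\mathcal X$ there exist $R$ convex recourse-stable regions $\mathcal D_1,\ldots,\mathcal D_R\subseteq\mathcal U$ (with respect to $x$) such that $\mathrm{cl}(\mathcal D_1)\cup\cdots\cup\mathrm{cl}(\mathcal D_R)=\mathcal U$, where $\mathrm{cl}$ denotes closure. Then, if $$k\ge\min\{R(n_\xi+1),\ |\mathcal Y|\},$$ a solution $x\in\mathcal X$ is optimal for the $k$-adaptability problem $$\inf_{\substack{x\in\mathcal X\\ y^1,\ldots,y^k\in\mathcal Y(x)}}\ \sup_{\xi\in\mathcal U}\ \inf_{i=1,\ldots,k} f(x,y^i,\xi)$$ if and only if it is optimal for the two-stage robust problem $$\inf_{x\in\mathcal X}\ \sup_{\xi\in\mathcal U}\ \inf_{y\in\mathcal Y(x)} f(x,y,\xi).$$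
   Context: $\mathcal X\subseteq\mathbb R^{n_x}$ is compact, $\mathcal Y\subset\mathbb Z^{n_y}$ is bounded (hence finite), $\mathcal Y(x)\subseteq\mathcal Y$ for each $x\in\mathcal X$, and $\mathcal U$ is nonempty. The function $f$ is $$f(x,y,\xi):=\begin{cases} g(x,y,\xi) & \text{if } A(\xi)x+B(\xi)y\ge h(\xi),\\ \infty & \text{otherwise,}\end{cases}$$ where $A(\xi)\in\mathbb R^{m\times n_x}$, $B(\xi)\in\mathbb R^{m\times n_y}$, $h(\xi)\in\mathbb R^m$ are affine functions of $\xi$. An infimum over the empty set is $+\infty$. $R$ and $k$ are positive integers. For given $x\in\mathcal X$, a convex set $\mathcal D\subseteq\mathcal U$ is called recourse-stable if $$\{y\in\mathcal Y(x):\exists\,\xi\in\mathcal D \text{ with } A(\xi)x+B(\xi)y\ge h(\xi)\}=\{y\in\mathcal Y(x):\forall\,\xi\in\mathcal D,\ A(\xi)x+B(\xi)y\ge h(\xi)\}.$$ A point $x\in\mathcal X$ is optimal for the two-stage robust problem if it attains its outer infimum over $\mathcal X$; it is optimal for the $k$-adaptability problem if $\inf_{y^1,\ldots,y^k\in\mathcal Y(x)}\sup_{\xi\in\mathcal U}\inf_{i}f(x,y^i,\xi)$ equals the optimal value of that problem (the $y^i$ need not be distinct). Standing assumption: the $k$-adaptability problem with $k=1$ has a feasible solution, i.e. there are $x\in\mathcal X$ and $y\in\mathcal Y(x)$ with $A(\xi)x+B(\xi)y\ge h(\xi)$ for all $\xi\in\mathcal U$; hence all these problems have finite optimal value. *)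

(* Defs.v *)
From HB Require Import structures.
From mathcomp Require Import all_boot all_order all_algebra.
From mathcomp Require Import finmap.
From mathcomp Require Import all_classical all_reals all_analysis.

Set Implicit Arguments.
Unset Strict Implicit.
Unset Printing Implicit Defensive.

Import Order.TTheory GRing.Theory Num.Theory.
Import numFieldNormedType.Exports.

Local Open Scope classical_set_scope.
Local Open Scope ring_scope.

Definition affine_map (R : realType) (V W : lmodType R) (F : V -> W) : Prop :=
  exists (L : {linear V -> W}) (c : W), forall v, F v = L v + c.

Definition concave_function (R : realType) (V : lmodType R)
    (D : set V) (f : V -> R) : Prop :=
  convex_function (D : set (convex_lmodType V)) (fun v => - f v).

(* Second-stage decisions are real column vectors; that they lie in the integer
   lattice is a condition on the set containing them. *)
Definition integer_vector (R : realType) (n : nat) (y : 'cV[R]_n) : Prop :=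
  forall i, y i 0 \is a Num.int.

Definition recourse_feasible (R : realType) (nx ny nxi m : nat)
    (A : 'cV[R]_nxi -> 'M[R]_(m, nx)) (B : 'cV[R]_nxi -> 'M[R]_(m, ny))
    (h : 'cV[R]_nxi -> 'cV[R]_m)
    (x : 'cV[R]_nx) (y : 'cV[R]_ny) (xi : 'cV[R]_nxi) : Prop :=
  forall i, h xi i 0 <= (A xi *m x + B xi *m y) i 0.

Definition recourse_cost (R : realType) (nx ny nxi m : nat)
    (g : 'cV[R]_nx -> 'cV[R]_ny -> 'cV[R]_nxi -> R)
    (A : 'cV[R]_nxi -> 'M[R]_(m, nx)) (B : 'cV[R]_nxi -> 'M[R]_(m, ny))
    (h : 'cV[R]_nxi -> 'cV[R]_m)
    (x : 'cV[R]_nx) (y : 'cV[R]_ny) (xi : 'cV[R]_nxi) : \bar R :=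
  if `[< recourse_feasible A B h x y xi >] then (g x y xi)%:E else +oo%E.

(* An empty D is recourse-stable only when Yx x is empty. *)
Definition recourse_stable (R : realType) (nx ny nxi m : nat)
    (U : set 'cV[R]_nxi) (Yx : 'cV[R]_nx -> set 'cV[R]_ny)
    (A : 'cV[R]_nxi -> 'M[R]_(m, nx)) (B : 'cV[R]_nxi -> 'M[R]_(m, ny))
    (h : 'cV[R]_nxi -> 'cV[R]_m)
    (x : 'cV[R]_nx) (D : set 'cV[R]_nxi) : Prop :=
  [/\ D `<=` U,
      convex_set (D : set (convex_lmodType 'cV[R]_nxi)) &
      [set y | Yx x y /\
               exists2 xi, D xi & recourse_feasible A B h x y xi] =
      [set y | Yx x y /\
               forall xi, D xi -> recourse_feasible A B h x y xi]].

(* Infima are taken in \bar R, so the infimum over the empty set is +oo. *)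

Definition two_stage_objective (R : realType) (nx ny nxi : nat)
    (U : set 'cV[R]_nxi) (Yx : 'cV[R]_nx -> set 'cV[R]_ny)
    (f : 'cV[R]_nx -> 'cV[R]_ny -> 'cV[R]_nxi -> \bar R)
    (x : 'cV[R]_nx) : \bar R :=
  ereal_sup [set ereal_inf [set f x y xi | y in Yx x] | xi in U].

Definition two_stage_value (R : realType) (nx ny nxi : nat)
    (X : set 'cV[R]_nx) (U : set 'cV[R]_nxi)
    (Yx : 'cV[R]_nx -> set 'cV[R]_ny)
    (f : 'cV[R]_nx -> 'cV[R]_ny -> 'cV[R]_nxi -> \bar R) : \bar R :=
  ereal_inf [set two_stage_objective U Yx f x | x in X].

Definition two_stage_optimal (R : realType) (nx ny nxi : nat)
    (X : set 'cV[R]_nx) (U : set 'cV[R]_nxi)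
    (Yx : 'cV[R]_nx -> set 'cV[R]_ny)
    (f : 'cV[R]_nx -> 'cV[R]_ny -> 'cV[R]_nxi -> \bar R)
    (x : 'cV[R]_nx) : Prop :=
  X x /\ two_stage_objective U Yx f x = two_stage_value X U Yx f.

Definition adapt_worst_case (R : realType) (nx ny nxi k : nat)
    (U : set 'cV[R]_nxi)
    (f : 'cV[R]_nx -> 'cV[R]_ny -> 'cV[R]_nxi -> \bar R)
    (x : 'cV[R]_nx) (ys : 'I_k -> 'cV[R]_ny) : \bar R :=
  ereal_sup [set ereal_inf [set f x (ys i) xi | i in [set: 'I_k]] | xi in U].

Definition adapt_objective (R : realType) (nx ny nxi : nat) (k : nat)
    (U : set 'cV[R]_nxi) (Yx : 'cV[R]_nx -> set 'cV[R]_ny)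
    (f : 'cV[R]_nx -> 'cV[R]_ny -> 'cV[R]_nxi -> \bar R)
    (x : 'cV[R]_nx) : \bar R :=
  ereal_inf [set adapt_worst_case U f x ys |
             ys in [set ys : 'I_k -> 'cV[R]_ny | forall i, Yx x (ys i)]].

Definition adapt_value (R : realType) (nx ny nxi : nat) (k : nat)
    (X : set 'cV[R]_nx) (U : set 'cV[R]_nxi)
    (Yx : 'cV[R]_nx -> set 'cV[R]_ny)
    (f : 'cV[R]_nx -> 'cV[R]_ny -> 'cV[R]_nxi -> \bar R) : \bar R :=
  ereal_inf [set adapt_worst_case U f p.1 p.2 |
             p in [set p : 'cV[R]_nx * ('I_k -> 'cV[R]_ny) |
                   X p.1 /\ forall i, Yx p.1 (p.2 i)]].

Definition adapt_optimal (R : realType) (nx ny nxi : nat) (k : nat)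
    (X : set 'cV[R]_nx) (U : set 'cV[R]_nxi)
    (Yx : 'cV[R]_nx -> set 'cV[R]_ny)
    (f : 'cV[R]_nx -> 'cV[R]_ny -> 'cV[R]_nxi -> \bar R)
    (x : 'cV[R]_nx) : Prop :=
  X x /\ adapt_objective k U Yx f x = adapt_value k X U Yx f.

(* Main.v *)
Require Import Defs.
From HB Require Import structures.
From mathcomp Require Import all_boot all_order all_algebra.
From mathcomp Require Import finmap.
From mathcomp Require Import all_classical all_reals all_analysis.
From mathcomp Require Import ring lra zify.

Set Implicit Arguments.
Unset Strict Implicit.
Unset Printing Implicit Defensive.

Import Order.TTheory GRing.Theory Num.Theory.
Import numFieldNormedType.Exports.

Local Open Scope classical_set_scope.
Local Open Scope ring_scope.

(* The two objectives agree at every x. Let w be a real above the two-stage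
   objective at x. Every xi then has a recourse y of cost at most w. On a
   recourse-stable region D the feasible recourses form a fixed finite set, and
   the sets {xi in D | g x y xi > w} with y in it are convex by concavity, with
   empty intersection; by Helly's theorem n_xi + 1 of them already have empty
   intersection, so n_xi + 1 recourses suffice on D. The points where a recourse
   is feasible with cost at most w form a closed set, so the same recourses
   suffice on cl(D), and R(n_xi + 1) of them suffice on U. If instead
   k >= |Y|, all of Y(x) can be used. *)

(** * Weighted sums in convex sets, Radon points and Helly's theorem *)

Lemma convex_set_comb (R : realFieldType) (V : lmodType R) (C : set V) :
  convex_set (C : set (convex_lmodType V)) ->
  forall (a b : V) (s t : R), C a -> C b -> 0 < s -> 0 < t ->
  exists2 c, C c & s *: a + t *: b = (s + t) *: c.
Proof.
move=> Ccvx a b s t Ca Cb s_gt0 t_gt0.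
have st_gt0 : 0 < s + t by rewrite addr_gt0.
have u01 : 0 <= s / (s + t) <= 1.
  by rewrite divr_ge0 ?(ltW s_gt0) ?(ltW st_gt0)//= ler_pdivrMr// mul1r lerDl ltW.
pose u := Itv01 (andP u01).1 (andP u01).2.
exists ((s / (s + t)) *: a + (1 - s / (s + t)) *: b).
  by apply: set_mem; exact: (Ccvx a b u (mem_set Ca) (mem_set Cb)).
rewrite scalerDr !scalerA; congr (_ *: _ + _ *: _); field; exact: lt0r_neq0.
Qed.

(** Induction on the list, merging the head with the point already obtained from the tail. The first
    alternative is the case of zero total mass, where no normalisation is possible. Points of zero
    weight may lie outside [C], which the Radon argument relies on. *)
Lemma convex_set_sum (R : realFieldType) (V : lmodType R) (C : set V)
    (I : eqType) (s : seq I) (w : I -> R) (p : I -> V) :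
  convex_set (C : set (convex_lmodType V)) ->
  (forall i, 0 <= w i) -> (forall i, 0 < w i -> C (p i)) ->
  (\sum_(i <- s) w i = 0 /\ \sum_(i <- s) w i *: p i = 0) \/
  (0 < \sum_(i <- s) w i /\
   exists2 c, C c & \sum_(i <- s) w i *: p i = (\sum_(i <- s) w i) *: c).
Proof.
move=> Ccvx w_ge0 Cp; elim: s => [|i s IH]; first by left; rewrite !big_nil.
rewrite !big_cons.
have [wi0|wi_neq0] := eqVneq (w i) 0; first by rewrite wi0 scale0r !add0r.
have wi_gt0 : 0 < w i by rewrite lt_neqAle eq_sym wi_neq0 w_ge0.
right; case: IH => [[-> ->]|[W_gt0 [c Cc ->]]].
  by rewrite !addr0; split => //; exists (p i) => //; exact: Cp.
split; first by rewrite addr_gt0.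
exact: convex_set_comb (Cp _ wi_gt0) Cc wi_gt0 W_gt0.
Qed.

(** The rows [(p i, 1)] with [i] in [J] number more than [n + 1], the number of columns, so the left
    kernel is nonzero. The column of ones turns a kernel vector into coefficients of sum zero. *)
Lemma affine_dependence (R : realFieldType) (n : nat) (I : finType)
    (J : {set I}) (p : I -> 'cV[R]_n) : (n.+1 < #|J|)%N ->
  exists l : I -> R, [/\ forall i, i \notin J -> l i = 0,
    exists i, l i != 0, \sum_i l i = 0 & \sum_i l i *: p i = 0].
Proof.
move=> nJ.
pose M : 'M[R]_(#|J|, n + 1) :=
  \matrix_(k < #|J|) row_mx (p (enum_val k))^T (const_mx 1).
have MR k j : M k (rshift n j) = 1 by rewrite mxE row_mxEr mxE.
have ML k j : M k (lshift 1 j) = p (enum_val k) j 0 by rewrite mxE row_mxEl mxE.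
have : kermx M != 0.
  rewrite -mxrank_eq0 mxrank_ker -lt0n subn_gt0.
  by apply: leq_ltn_trans (rank_leq_col _) _; rewrite addn1.
case/rowV0Pn => v /sub_kermxP vM v_neq0.
(* This transports [v] from positions in [J] to [I]: the sum has one term when [i] is in [J] and
   none otherwise. *)
pose l i := \sum_(k | enum_val k == i) v 0 k.
have l_sum (W : lmodType R) (q : I -> W) :
    \sum_i l i *: q i = \sum_k v 0 k *: q (enum_val k).
  rewrite [RHS](partition_big (fun k => enum_val k) predT)//=.
  apply: eq_bigr => i _; rewrite scaler_suml.
  by apply: eq_bigr => k /eqP ->.
have vrow : \sum_k v 0 k *: row k M = 0 by rewrite -mulmx_sum_row.
exists l; split.
- move=> i iJ; rewrite /l big_pred0// => k; apply/negbTE.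
  by apply: contraNneq iJ => <-; exact: enum_valP.
- have [k vk] : exists k, v 0 k != 0.
    apply/existsP; apply: contraNT v_neq0 => /existsPn v0.
    by apply/eqP/rowP => k; rewrite mxE; apply/eqP; rewrite -[_ == _]negbK.
  exists (enum_val k); rewrite /l (big_pred1 k)// => k'.
  by rewrite /= (inj_eq enum_val_inj).
- transitivity (\sum_i l i *: (1 : R^o)).
    by apply: eq_bigr => i _; rewrite /GRing.scale/= mulr1.
  rewrite l_sum.
  have /rowP/(_ (rshift n ord0)) := vrow.
  rewrite summxE mxE => vrow0; rewrite -[RHS]vrow0.
  by apply: eq_bigr => k _; rewrite [RHS]mxE [X in _ * X]mxE MR.
- rewrite l_sum; apply/colP => j.
  have /rowP/(_ (lshift 1 j)) := vrow.
  rewrite !summxE [X in _ = X]mxE [X in _ -> _ = X]mxE => vrow0; rewrite -[RHS]vrow0.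
  by apply: eq_bigr => k _; rewrite mxE [RHS]mxE [X in _ = _ * X]mxE ML.
Qed.

(* The common point is the Radon point of the [p i]. *)
Lemma radon_common_point (R : realFieldType) (n : nat) (I : finType)
    (J : {set I}) (F : I -> set 'cV[R]_n) (p : I -> 'cV[R]_n) :
  (forall i, convex_set (F i : set (convex_lmodType 'cV[R]_n))) ->
  (n.+1 < #|J|)%N ->
  (forall i j, i \in J -> j \in J -> i != j -> F j (p i)) ->
  exists z, forall j, j \in J -> F j z.
Proof.
move=> Fcvx nJ Fp.
have [l [lJ [i0 li0] sl slp]] := affine_dependence p nJ.
(* The positive and negative parts of [l] have equal total mass and equal weighted sums of the
   [p i], so both represent the same normalised point. *)
pose w i := Num.max (l i) 0; pose w' i := Num.max (- l i) 0.
have w_ge0 i : 0 <= w i by rewrite le_max lexx orbT.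
have w'_ge0 i : 0 <= w' i by rewrite le_max lexx orbT.
have wl i : w i - w' i = l i.
  by rewrite /w /w'; case: (leP (l i) 0); case: (leP (- l i) 0); lra.
have sw : \sum_i w i = \sum_i w' i.
  apply/eqP; rewrite -subr_eq0 -sumrB -[X in _ == X]sl.
  by apply/eqP/eq_bigr.
have swp : \sum_i w i *: p i = \sum_i w' i *: p i.
  apply/eqP; rewrite -subr_eq0 -sumrB -[X in _ == X]slp.
  by apply/eqP/eq_bigr => i _; rewrite -scalerBl wl.
have W_neq0 : \sum_i w i != 0.
  apply: contra li0 => /eqP W0; rewrite -wl.
  move/psumr_eq0P : (W0) => -> //.
  by move: W0; rewrite sw => /psumr_eq0P -> //; rewrite subrr.
(* Weights [q] representing the Radon point place it in [F j] as soon as their support lies in [J]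
   and avoids [j]. One of [w], [w'] always qualifies, according to the sign of [l j]. *)
have FW (q : I -> R) j : j \in J -> (forall i, 0 <= q i) ->
    (forall i, 0 < q i -> l i != 0 /\ i != j) ->
    \sum_i q i = \sum_i w i -> \sum_i q i *: p i = \sum_i w i *: p i ->
    F j ((\sum_i w i)^-1 *: \sum_i w i *: p i).
  move=> jJ q_ge0 qj qw qwp.
  have Fq i : 0 < q i -> F j (p i).
    case/qj => li ij; apply: Fp => //; apply: contraR li => /lJ ->; exact: eqxx.
  have := convex_set_sum (index_enum I) (Fcvx j) q_ge0 Fq.
  rewrite qw qwp => -[[/eqP]|[_ [c Fc ->]]]; first by rewrite (negPf W_neq0).
  by rewrite scalerA mulVf// scale1r.
exists ((\sum_i w i)^-1 *: \sum_i w i *: p i) => j jJ.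
have [lj|lj] := leP (l j) 0.
- apply: (FW w) => // i; rewrite lt_max ltxx orbF => li.
  by split; [exact: lt0r_neq0|apply: contraTneq li => ->; rewrite -leNgt].
- apply: (FW w') => // i; rewrite lt_max ltxx orbF oppr_gt0 => li.
  split; first by rewrite lt_eqF.
  by apply: contraTneq li => ->; rewrite -leNgt ltW.
Qed.

Lemma helly (R : realFieldType) (n : nat) (I : finType)
    (F : I -> set 'cV[R]_n) (J : {set I}) :
  (forall i, convex_set (F i : set (convex_lmodType 'cV[R]_n))) ->
  ~ (exists z, forall j, j \in J -> F j z) ->
  exists J' : {set I}, [/\ J' \subset J, (#|J'| <= n.+1)%N &
    ~ (exists z, forall j, j \in J' -> F j z)].
Proof.
move=> Fcvx; have [N] := ubnP #|J|; elim: N J => // N IH J /ltnSE JN J0.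
have [Jn|nJ] := leqP #|J| n.+1; first by exists J.
have [[i iJ Ji0]|noJ] := pselect (exists2 i, i \in J &
    ~ (exists z, forall j, j \in (J :\ i)%SET -> F j z)).
  have [|J' [J'J J'n J'0]] := IH (J :\ i)%SET _ Ji0.
    by move: JN; rewrite (cardsD1 i) iJ.
  by exists J'; split => //; apply: fintype.subset_trans J'J (subD1set _ _).
have /choice[p Fp] : forall i, exists z, i \in J ->
    forall j, j \in (J :\ i)%SET -> F j z.
  move=> i; have [iJ|iJ] := boolP (i \in J); last by exists 0.
  apply: contrapT => noz; apply: noJ; exists i => // -[z Fz].
  by apply: noz; exists z.
case: J0; apply: (radon_common_point (p := p)) => // i j iJ jJ ij.
by apply: Fp => //; rewrite !inE eq_sym ij.
Qed.

(** * Continuity of the data, closed and convex level sets, finiteness of bounded integer sets *)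

Lemma continuous_sum (R : numFieldType) (T : topologicalType) (I : Type)
    (s : seq I) (f : I -> T -> R) :
  (forall i, continuous (f i)) -> continuous (fun t => \sum_(i <- s) f i t).
Proof.
move=> f_cont; elim: s => [|i s IH] t.
  by under eq_fun do rewrite big_nil; exact: cst_continuous.
under eq_fun do rewrite big_cons.
exact: continuousD (f_cont i t) (IH t).
Qed.

Lemma affine_map_entry_continuous (R : realType) (n p q : nat)
    (F : 'cV[R]_n -> 'M[R]_(p, q)) i j :
  affine_map F -> continuous (fun v => F v i j).
Proof.
move=> [L [c FE]].
(* Expanding [v] in the standard basis makes each entry an explicit first-degree polynomial in the
   coordinates of [v]. *)
have -> : (fun v => F v i j) =
    (fun v => (\sum_k v k 0 * L (delta_mx k 0) i j) + c i j).
  apply/funext => v; rewrite FE mxE; congr (_ + _).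
  rewrite [in LHS](matrix_sum_delta v) linear_sum summxE.
  by apply: eq_bigr => k _; rewrite big_ord1 linearZ mxE.
move=> v; apply: continuousD; last exact: cst_continuous.
apply: continuous_sum => k {}v; apply: continuousM; last exact: cst_continuous.
exact: coord_continuous.
Qed.

Lemma closed_recourse_feasible (R : realType) (nx ny nxi m : nat)
    (A : 'cV[R]_nxi -> 'M[R]_(m, nx)) (B : 'cV[R]_nxi -> 'M[R]_(m, ny))
    (h : 'cV[R]_nxi -> 'cV[R]_m) x y :
  affine_map A -> affine_map B -> affine_map h ->
  closed [set xi | recourse_feasible A B h x y xi].
Proof.
move=> Aaff Baff haff.
have mul_cont p q (F : 'cV[R]_nxi -> 'M[R]_(p, q)) (v : 'cV[R]_q) i :
    affine_map F -> continuous (fun xi => (F xi *m v) i 0).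
  move=> Faff; under eq_fun do rewrite mxE.
  apply: continuous_sum => k xi; apply: continuousM; last exact: cst_continuous.
  exact: affine_map_entry_continuous.
(* One closed half-line preimage per constraint row; the slack is a difference of continuous
   functions. *)
have -> : [set xi | recourse_feasible A B h x y xi] =
    \bigcap_(i in setT) ((fun xi => (A xi *m x) i 0 + (B xi *m y) i 0 - h xi i 0)
                         @^-1` [set z | 0 <= z]).
  have feasE xi i : (h xi i 0 <= (A xi *m x + B xi *m y) i 0) =
      (0 <= (A xi *m x) i 0 + (B xi *m y) i 0 - h xi i 0).
    by rewrite subr_ge0 [in LHS]mxE.
  by apply/seteqP; split => xi /= feas i => [_|];
    [rewrite /= -feasE; exact: feas|rewrite feasE; exact: feas].
apply: closed_bigI => i _; apply: closed_comp (@closed_ge _ _) => xi _.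
apply: (@continuousB _ _ _ (fun xi => (A xi *m x) i 0 + (B xi *m y) i 0)
                           (fun xi => h xi i 0)); last first.
  exact: affine_map_entry_continuous.
by apply: continuousD; exact: mul_cont.
Qed.

Lemma within_continuous_section (R : realType) (T1 T2 : topologicalType)
    (P : set T1) (U : set T2) (g : T1 * T2 -> R) (a : T1) :
  {within P `*` U, continuous g} -> P a ->
  {within U, continuous (fun b => g (a, b))}.
Proof.
move=> /subspace_continuousP g_cont Pa; apply/subspace_continuousP => b Ub.
apply: cvg_comp (g_cont (a, b) (conj Pa Ub)) => W /=.
rewrite /within/= => -[[W1 W2] /= [W1a W2b] W12].
change (nbhs b [set b' | U b' -> W (a, b')]).
apply: filterS W2b => b' W2b' Ub'.
apply: (W12 (a, b')) => /=; last by [].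
by split => //; exact: nbhs_singleton.
Qed.

Lemma closed_within_le (R : realType) (T : topologicalType) (U : set T)
    (g : T -> R) (w : R) : closed U -> {within U, continuous g} ->
  closed [set t | U t /\ g t <= w].
Proof.
move=> U_closed /continuous_closedP/(_ _ (@closed_le R w)).
by rewrite -(closed_setIS _ U_closed) setIC.
Qed.

Lemma concave_superlevel_convex (R : realType) (V : lmodType R)
    (U D : set V) (g : V -> R) (w : R) :
  concave_function U g -> D `<=` U ->
  convex_set (D : set (convex_lmodType V)) ->
  convex_set ([set v | D v /\ w < g v] : set (convex_lmodType V)).
Proof.
move=> g_conc DU Dcvx a b t /set_mem[Da wa] /set_mem[Db wb].
apply/mem_set; split; first exact: set_mem (Dcvx a b t (mem_set Da) (mem_set Db)).
have := g_conc t a b (mem_set (DU _ Da)) (mem_set (DU _ Db)).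
have : 0 < t%:num * (g a - w) + (1 - t%:num) * (g b - w).
  by apply: (@convR_gt0 R); rewrite subr_gt0.
have key (u ga gb gc : R) : 0 < u * (ga - w) + (1 - u) * (gb - w) ->
  - gc <= u * - ga + (1 - u) * - gb -> w < gc by lra.
exact: key.
Qed.

(** Coordinates are integers in [[-N, N]]; shifting by [N] encodes them in ['I_(N + N).+1], so [Y]
    lies in the image of a finite type. *)
Lemma bounded_integer_finite (R : realType) (n : nat) (Y : set 'cV[R]_n) :
  (forall y, Y y -> integer_vector y) -> bounded_set Y -> finite_set Y.
Proof.
move=> Yint /ex_strict_bound_gt0[M M_gt0 YM].
have [N MN] : exists N, M < N%:R by exists (Num.bound M); rewrite archi_boundP ?ltW.
pose F (u : 'cV['I_(N + N).+1]_n) : 'cV[R]_n := \col_i ((u i 0)%:R - N%:R).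
apply: (@sub_finite_set _ _ (range F)); last first.
  exact/finite_image/finite_finset.
move=> y Yy; exists (\col_i inord `|(Num.floor (y i 0) + N%:Z)%R|%N) => //.
apply/colP => i; rewrite !mxE.
have /intrP[z yz] := Yint _ Yy i.
(* The norm of a column is its largest absolute entry, hence bounds every coordinate. *)
have zN : `|z| <= N.
  rewrite -(ler_int R) intr_norm -yz.
  apply: le_trans (ltW (lt_trans (YM _ Yy) MN)).
  rewrite [leRHS]/Num.norm/= mx_normrE.
  exact: (le_bigmax_cond _ (j := (i, 0)) (fun ij : 'I_n * 'I_1 => `|y ij.1 ij.2|)).
have zN_ge0 : 0 <= z + N by lia.
rewrite yz intrKfloor inordK; last by lia.
by rewrite natr_absz ger0_norm// intrD addrK.
Qed.

(** * Comparison of the adaptability and two-stage objectives *)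

Lemma two_stage_le_adapt_objective (R : realType) (nx ny nxi k : nat)
    (U : set 'cV[R]_nxi) (Yx : 'cV[R]_nx -> set 'cV[R]_ny) f x :
  (two_stage_objective U Yx f x <= adapt_objective k U Yx f x)%E.
Proof.
apply: le_ereal_inf_tmp => _ [ys Yys <-].
apply: ge_ereal_sup => _ [xi Uxi <-].
apply: le_ereal_sup_tmp; exists (ereal_inf [set f x (ys i) xi | i in [set: 'I_k]]).
  by exists xi.
by apply: ereal_inf_le_tmp => _ [i _ <-]; exists (ys i).
Qed.

Lemma adapt_objective_le (R : realType) (nx ny nxi k : nat)
    (U : set 'cV[R]_nxi) (Yx : 'cV[R]_nx -> set 'cV[R]_ny) f x
    (s : seq 'cV[R]_ny) (w : \bar R) : U !=set0 ->
  (size s <= k)%N -> (forall y, y \in s -> Yx x y) ->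
  (forall xi, U xi -> exists2 y, y \in s & (f x y xi <= w)%E) ->
  (adapt_objective k U Yx f x <= w)%E.
Proof.
move=> [xi0 Uxi0] sk sY sw; have [y0 y0s _] := sw _ Uxi0.
(* A list shorter than [k] is padded by repeating [y0], which is in the list because [U] is
   nonempty. *)
pose ys (i : 'I_k) := nth y0 s i.
apply: ge_ereal_inf; exists (adapt_worst_case U f x ys).
  exists ys => // i /=; have [/(mem_nth y0)/sY//|si] := ltnP i (size s).
  by rewrite /ys nth_default//; exact: sY.
apply: ge_ereal_sup => _ [xi Uxi <-]; have [y ys' fw] := sw _ Uxi.
have yk : (index y s < k)%N by rewrite (leq_trans _ sk)// index_mem.
apply: ge_ereal_inf; exists (f x y xi) => //.
by exists (Ordinal yk) => //; rewrite /ys nth_index.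
Qed.

(** Only the upper bound needs the covers. Taking [w] strictly above the two-stage objective lets
    each inner infimum be replaced by an actual recourse of cost at most [w]; then [w] decreases to
    the objective. *)
Lemma adapt_objective_eq (R : realType) (nx ny nxi k : nat)
    (U : set 'cV[R]_nxi) (Yx : 'cV[R]_nx -> set 'cV[R]_ny) f x : U !=set0 ->
  (forall w : R, (two_stage_objective U Yx f x < w%:E)%E ->
    exists s : seq 'cV[R]_ny, [/\ (size s <= k)%N,
      forall y, y \in s -> Yx x y &
      forall xi, U xi -> exists2 y, y \in s & (f x y xi <= w%:E)%E]) ->
  adapt_objective k U Yx f x = two_stage_objective U Yx f x.
Proof.
move=> U0 cover; apply/eqP; rewrite eq_le two_stage_le_adapt_objective andbT.
have le_w (w : R) : (two_stage_objective U Yx f x < w%:E)%E ->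
    (adapt_objective k U Yx f x <= w%:E)%E.
  by move=> /cover[s [sk sY sw]]; exact: adapt_objective_le sw.
move: le_w; case: (two_stage_objective U Yx f x) => [v||] le_w.
- apply/lee_addgt0Pr => e e_gt0; rewrite -EFinD; apply: le_w.
  by rewrite lte_fin ltrDl.
- exact: leey.
- have {}le_w w := le_w w (ltNyr w).
  move: le_w; case: (adapt_objective _ _ _ _ _) => [v||] le_w //.
    by have := le_w (v - 1)%R; rewrite lee_fin lerBrDr gerDl ler10.
  by have := le_w 0.
Qed.

Lemma adapt_value_eq (R : realType) (nx ny nxi k : nat)
    (X : set 'cV[R]_nx) (U : set 'cV[R]_nxi)
    (Yx : 'cV[R]_nx -> set 'cV[R]_ny) f :
  adapt_value k X U Yx f = ereal_inf [set adapt_objective k U Yx f x | x in X].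
Proof.
apply/eqP; rewrite eq_le; apply/andP; split.
  apply: le_ereal_inf_tmp => _ [x Xx <-]; apply: le_ereal_inf_tmp => _ [ys Yys <-].
  by apply: ereal_inf_lbound; exists (x, ys).
apply: le_ereal_inf_tmp => _ [[x ys] /= [Xx Yys] <-].
apply: ge_ereal_inf; exists (adapt_objective k U Yx f x); first by exists x.
by apply: ereal_inf_lbound; exists ys.
Qed.

(** * Finite covers of a recourse-stable region and of its closure *)

Lemma recourse_cost_leP (R : realType) (nx ny nxi m : nat)
    (g : 'cV[R]_nx -> 'cV[R]_ny -> 'cV[R]_nxi -> R)
    (A : 'cV[R]_nxi -> 'M[R]_(m, nx)) (B : 'cV[R]_nxi -> 'M[R]_(m, ny))
    (h : 'cV[R]_nxi -> 'cV[R]_m) x y xi (w : R) :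
  (recourse_cost g A B h x y xi <= w%:E)%E <->
  recourse_feasible A B h x y xi /\ g x y xi <= w.
Proof.
rewrite /recourse_cost; case: asboolP => [feas|nfeas].
  by rewrite lee_fin; split => [|[]].
by rewrite leye_eq; split => [|[]].
Qed.

Lemma recourse_stable_cover (R : realType) (nx ny nxi m : nat)
    (U D : set 'cV[R]_nxi) (Yx : 'cV[R]_nx -> set 'cV[R]_ny)
    (g : 'cV[R]_nx -> 'cV[R]_ny -> 'cV[R]_nxi -> R)
    (A : 'cV[R]_nxi -> 'M[R]_(m, nx)) (B : 'cV[R]_nxi -> 'M[R]_(m, ny))
    (h : 'cV[R]_nxi -> 'cV[R]_m) x (w : R) :
  finite_set (Yx x) -> recourse_stable U Yx A B h x D ->
  (forall y, Yx x y -> concave_function U (g x y)) ->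
  (forall xi, D xi ->
    exists2 y, Yx x y & (recourse_cost g A B h x y xi <= w%:E)%E) ->
  exists s : seq 'cV[R]_ny, [/\ (size s <= nxi.+1)%N,
    forall y, y \in s -> Yx x y &
    forall xi, D xi ->
      exists2 y, y \in s & (recourse_cost g A B h x y xi <= w%:E)%E].
Proof.
move=> Yfin [DU Dcvx Dstable] gconc cover.
pose Z := [set y | Yx x y /\ forall xi, D xi -> recourse_feasible A B h x y xi].
have Zfin : finite_set Z by apply: sub_finite_set Yfin => y [].
have ZP y xi : Yx x y -> D xi -> recourse_feasible A B h x y xi -> Z y.
  (* Stability enters here: a recourse feasible at one point of [D] is feasible on all of [D]. *)
  by move=> Yy Dxi feas; rewrite /Z -Dstable; split => //; exists xi.
have valZ (j : fset_set Z) : Z (val j).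
  by have := valP j; rewrite in_fset_set// inE.
pose F (j : fset_set Z) : set 'cV[R]_nxi := [set xi | D xi /\ w < g x (val j) xi].
have Fcvx j : convex_set (F j : set (convex_lmodType 'cV[R]_nxi)).
  by apply: concave_superlevel_convex DU Dcvx; apply: gconc; case: (valZ j).
have zNF z : D z -> exists j : fset_set Z, ~ F j z.
  move=> Dz; have [y Yy /recourse_cost_leP[feas gw]] := cover _ Dz.
  have yZ : y \in fset_set Z by rewrite in_fset_set// inE; exact: ZP feas.
  by exists [` yZ]%fset => -[_ /=]; rewrite ltNge gw.
(* A point of [D] supplies an index in [Z], without which a common point of the [F j] would not be
   known to lie in [D]. For empty [D] the empty list does. *)
have [[xi0 Dxi0]|D0] := pselect (D !=set0); last first.
  by exists [::]; split => // xi Dxi; case: D0; exists xi.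
have [|J [_ Jn J0]] := helly (J := [set: fset_set Z]%SET) Fcvx.
  move=> [z Fz]; have [j0 _] := zNF _ Dxi0.
  have [Dz _] := Fz j0 (finset.in_setT _).
  by have [j] := zNF _ Dz; apply; exact: Fz (finset.in_setT _).
exists [seq val j | j <- enum J]; split.
- by rewrite size_map -cardE.
- by move=> _ /mapP[j _ ->]; case: (valZ j).
(* If no selected recourse worked at [xi], then [xi] would lie in every selected [F j], against
   Helly. *)
- move=> xi Dxi; apply: contrapT => noy; apply: J0; exists xi => j jJ.
  split => //; rewrite ltNge; apply/negP => gw; apply: noy; exists (val j).
    by apply: map_f; rewrite mem_enum.
  by apply/recourse_cost_leP; split => //; case: (valZ j) => _; apply.
Qed.

(** A finite union of closed sets is closed, so once it contains [D] it contains the closure of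
    [D]. *)
Lemma closure_cover (T : topologicalType) (Y : choiceType) (s : seq Y)
    (S : Y -> set T) (D : set T) :
  (forall y, y \in s -> closed (S y)) ->
  (forall t, D t -> exists2 y, y \in s & S y t) ->
  forall t, closure D t -> exists2 y, y \in s & S y t.
Proof.
move=> Sclosed DS t.
have Uclosed : closed (\bigcup_(y in [set` s]) S y) by exact: closed_bigcup.
have DU : D `<=` \bigcup_(y in [set` s]) S y by move=> u /DS[y ys Sy]; exists y.
by move=> /(closureS DU); rewrite -(closure_id _).1// => -[y ys Sy]; exists y.
Qed.

(** * Assembly of the covers and equivalence of the two optimality notions *)

Theorem theorem11 (R : realType) (nx ny nxi m : nat)
    (X : set 'cV[R]_nx) (Y : set 'cV[R]_ny) (U : set 'cV[R]_nxi)
    (Yx : 'cV[R]_nx -> set 'cV[R]_ny)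
    (g : 'cV[R]_nx -> 'cV[R]_ny -> 'cV[R]_nxi -> R)
    (A : 'cV[R]_nxi -> 'M[R]_(m, nx)) (B : 'cV[R]_nxi -> 'M[R]_(m, ny))
    (h : 'cV[R]_nxi -> 'cV[R]_m)
    (r k : nat)
    (r_gt0 : (0 < r)%N) (k_gt0 : (0 < k)%N)
    (X_compact : compact X)
    (Y_integer : forall y, Y y -> integer_vector y)
    (Y_bounded : bounded_set Y)
    (Yx_sub : forall x, X x -> Yx x `<=` Y)
    (U_nonempty : U !=set0)
    (U_convex : convex_set (U : set (convex_lmodType 'cV[R]_nxi)))
    (U_compact : compact U)
    (A_affine : affine_map A) (B_affine : affine_map B)
    (h_affine : affine_map h)
    (g_continuous : {within X `*` Y `*` U,
       continuous (fun p : 'cV[R]_nx * 'cV[R]_ny * 'cV[R]_nxi =>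
                     g p.1.1 p.1.2 p.2)})
    (g_concave : forall x y, X x -> Y y -> concave_function U (g x y))
    (static_feasible : exists x y, [/\ X x, Yx x y &
       forall xi, U xi -> recourse_feasible A B h x y xi])
    (stable_cover : forall x, X x -> exists D : 'I_r -> set 'cV[R]_nxi,
       (forall i, recourse_stable U Yx A B h x (D i)) /\
       \bigcup_(i in [set: 'I_r]) closure (D i) = U)
    (k_large : (minn (r * nxi.+1) #|` fset_set Y| <= k)%N) :
  let f := recourse_cost g A B h in
  forall x, X x ->
    (adapt_optimal k X U Yx f x <-> two_stage_optimal X U Yx f x).
Proof.
move=> f x0 Xx0.
have Yfin : finite_set Y by exact: bounded_integer_finite.
have Yxfin x : X x -> finite_set (Yx x).
  by move=> /Yx_sub YxY; exact: sub_finite_set Yfin.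
have U_closed : closed U by apply: compact_closed => //; exact: norm_hausdorff.
(* Equal objectives on [X] have equal infima over [X], so the two optimality conditions become the
   same equation. *)
suff objE x : X x -> adapt_objective k U Yx f x = two_stage_objective U Yx f x.
  have valE : adapt_value k X U Yx f = two_stage_value X U Yx f.
    rewrite adapt_value_eq /two_stage_value; congr ereal_inf.
    by apply: eq_imagel => x /objE.
  by rewrite /adapt_optimal /two_stage_optimal objE// valE.
move=> Xx; apply: adapt_objective_eq => // w vw.
have cover xi : U xi -> exists2 y, Yx x y & (f x y xi <= w%:E)%E.
  move=> Uxi; have : (ereal_inf [set f x y xi | y in Yx x] < w%:E)%E.
    by apply: le_lt_trans vw; apply: ereal_sup_ubound; exists xi.
  by move=> /ereal_inf_lt[_ [y Yy <-] /ltW fw]; exists y.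
move: k_large; rewrite geq_min => /orP[rk|Yk]; last first.
  exists (fset_set (Yx x)); split.
  - apply: leq_trans Yk; apply: fsubset_leq_card.
    by rewrite -fset_set_sub; [exact: Yx_sub _ Xx|exact: Yxfin|].
  - by move=> y; rewrite in_fset_set ?inE//; exact: Yxfin.
  - move=> xi /cover[y Yy fw]; exists y => //.
    by rewrite in_fset_set ?inE//; exact: Yxfin.
have [D [Dstable DU]] := stable_cover _ Xx.
have DsubU i : D i `<=` U by case: (Dstable i).
have /choice[s sP] : forall i, exists s : seq 'cV[R]_ny,
    [/\ (size s <= nxi.+1)%N, forall y, y \in s -> Yx x y &
      forall xi, D i xi -> exists2 y, y \in s & (f x y xi <= w%:E)%E].
  move=> i; apply: recourse_stable_cover (Yxfin _ Xx) (Dstable i) _ _.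
    by move=> y /(Yx_sub _ Xx); exact: g_concave.
  by move=> xi /DsubU; exact: cover.
(* Concatenating one list of length at most [nxi.+1] per region gives at most [r * nxi.+1]
   recourses. *)
exists (flatten [seq s i | i <- enum 'I_r]); split.
- rewrite size_flatten /shape -map_comp sumnE big_map big_enum/=.
  apply: leq_trans rk; rewrite -[X in (_ <= X * _)%N]card_ord -sum_nat_const.
  by apply: leq_sum => i _; case: (sP i).
- by move=> y /flatten_mapP[i _]; have [_ + _] := sP i; apply.
- rewrite -DU => xi [i _ Dixi]; have [_ sY sD] := sP i.
  (* Membership in [U] is part of [S y] because [g] is continuous only on [U]; as [U] is closed,
     [S y] is closed in the whole space. *)
  pose S y := [set xi | U xi /\ g x y xi <= w] `&`
              [set xi | recourse_feasible A B h x y xi].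
  have S_closed y : y \in s i -> closed (S y).
    move=> /sY/(Yx_sub _ Xx) Yy; apply: closedI; last exact: closed_recourse_feasible.
    apply: closed_within_le => //.
    exact: (within_continuous_section (a := (x, y)) g_continuous).
  have DS xi' : D i xi' -> exists2 y, y \in s i & S y xi'.
    move=> Dxi'; have [y ys /recourse_cost_leP[feas gw]] := sD _ Dxi'.
    by exists y => //; split => //; split => //; exact: DsubU Dxi'.
  have [y ys [[_ gw] feas]] := closure_cover S_closed DS Dixi.
  exists y; last exact/recourse_cost_leP.
  by apply/flatten_mapP; exists i => //; rewrite mem_enum.
Qed.
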